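(* Let $n,k$ be integers with $k\geq 8$ and $2k+1\leq n\leq 4k$. Suppose that $\mathcal{F},\mathcal{G}\subset \binom{[n]}{k}$ are cross-intersecting and both are non-trivial. Then \[ |\mathcal{F}||\mathcal{G}|\leq \left(\binom{n-1}{k-1}-\binom{n-k-1}{k-1}+1\right)^2 . \]
   Context: $[n]=\{1,2,\ldots,n\}$ and $\binom{[n]}{k}$ denotes the family of all $k$-element subsets of $[n]$. Two families $\mathcal{F},\mathcal{G}$ are cross-intersecting if $F\cap G\neq\emptyset$ for all $F\in\mathcal{F}$, $G\in\mathcal{G}$. A family $\mathcal{F}$ is non-trivial if $\bigcap\{F\colon F\in\mathcal{F}\}=\emptyset$. *)

(* Defs.v *)
From mathcomp Require Import all_boot.
Set Implicit Arguments. Unset Strict Implicit. Unset Printing Implicit Defensive.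

Definition k_uniform (n k : nat) (F : {set {set 'I_n}}) : Prop :=
  forall A, A \in F -> #|A| = k.

Definition cross_intersecting (n : nat) (F G : {set {set 'I_n}}) : Prop :=
  forall A B, A \in F -> B \in G -> A :&: B != set0.

Definition non_trivial (n : nat) (F : {set {set 'I_n}}) : Prop :=
  \bigcap_(A in F) A = set0.

(* Main.v *)
Require Import Defs.
From mathcomp Require Import all_boot.
From mathcomp Require Import zify ring.
From Stdlib Require Import Classical.
Set Implicit Arguments. Unset Strict Implicit. Unset Printing Implicit Defensive.

(* Write N = C(n-1,k-1), t = C(n-k-1,k-1) and h = N - t + 1.  Split both families
   by the intersection with a pair {i, j}; write F(ij), F(i), F(j), F(0) for the
   four links on the other n - 2 points E, and call a set a ballot set if some
   initial segment of E contains at least two more of its members than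
   non-members.
   (1) If the families are shifted on E, the links of i alone and of j alone are
   nonempty, and F(0), G(0) consist of ballot sets, then |F| + |G| <= 2h.  Indeed
   F(i), G(j) are nonempty and cross-intersecting, so they have at most
   C(n-2,k-1) - t + 1 members in total; and a family of ballot k-sets on E is
   disjoint from at least as many (k-2)-sets as it has members, by reflection, so
   F(ij), G(0) have at most C(n-2,k-2) members in total.
   (2) If every member of F is a ballot set for some order of the whole ground
   set, the same reflection argument bounds |G| by C(n,k) - rho |F| with
   rho = (n-k)(n-k-1) / (k(k-1)), and then |F||G| <= C(n,k)^2 / (4 rho) <= h^2.
   Shift as long as both families stay non-trivial.  If this ends with two shifted
   families, take the two smallest points for i, j: a non-ballot set in G(0) makes
   every member of F a ballot set, by cross-intersection.  Otherwise some shift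
   j -> i makes F, say, a star at i; then F is covered by {i, j}, all links in (1)
   are nonempty once F is saturated, and one may shift on E only.  Now a non-ballot
   set in G(0) makes every member of the shifted star a ballot set for the order
   that begins with i. *)

(** * Uniform families and disjointness shadows *)

Definition subsets (T : finType) (E : {set T}) (k : nat) : {set {set T}} :=
  [set A : {set T} | A \subset E & #|A| == k].

Definition cross (T : finType) (P Q : {set {set T}}) :=
  forall A B, A \in P -> B \in Q -> A :&: B != set0.

(** This is the usual lower shadow of the complements in [E]: [B] counts when it fits inside
    [E :\: A] for some [A] in [H]. A family that cross-intersects [H] contains no such [B]. *)
Definition shadow (T : finType) (E : {set T}) (l : nat) (H : {set {set T}}) :
    {set {set T}} :=
  [set B in subsets E l | [exists A in H, A :&: B == set0]].

Section Uniform.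
Variable T : finType.
Implicit Types (E A B : {set T}) (P Q H : {set {set T}}).

Lemma subsetsP E k A : reflect (A \subset E /\ #|A| = k) (A \in subsets E k).
Proof. by rewrite inE; apply: (iffP andP) => [[? /eqP]|[? ->]]. Qed.

Lemma card_subsets E k : #|subsets E k| = 'C(#|E|, k).
Proof. exact: cards_draws. Qed.

Lemma shadowP E l H B :
  reflect (B \in subsets E l /\ exists2 A, A \in H & A :&: B = set0)
          (B \in shadow E l H).
Proof.
apply: (iffP setIdP) => [[Bl /exists_inP[A AH /eqP AB]]|[Bl [A AH AB]]].
  by split=> //; exists A.
by split=> //; apply/exists_inP; exists A => //; apply/eqP.
Qed.

Lemma card_shadow_cross E l H Q :
  Q \subset subsets E l -> cross H Q -> #|shadow E l H| + #|Q| <= 'C(#|E|, l).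
Proof.
move=> QE HQ; rewrite -card_subsets -cardsUI.
have -> : shadow E l H :&: Q = set0.
  apply/setP => B; rewrite in_setI in_set0; apply/negP.
  case/andP=> /shadowP[_ [A AH AB]] BQ.
  by have := HQ _ _ AH BQ; rewrite AB eqxx.
rewrite cards0 addn0; apply: subset_leq_card; rewrite subUset QE andbT.
by apply/subsetP => B /shadowP[].
Qed.

(** Both sides count ordered pairs of disjoint sets of sizes [k] and [l]. *)
Lemma bin_mulC_disjoint n k l :
  'C(n, k) * 'C(n - k, l) = 'C(n, l) * 'C(n - l, k).
Proof.
case: (leqP (k + l) n) => [kl|kl]; last first.
  have z u v : n < u + v -> 'C(n, u) * 'C(n - u, v) = 0.
    move=> uv; apply/eqP; rewrite muln_eq0; case: (ltnP n u) => nu.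
      by rewrite bin_small.
    by rewrite orbC bin_small //; lia.
  by rewrite !z // addnC.
apply/eqP; rewrite -(eqn_pmul2r (fact_gt0 (n - k - l))).
rewrite -(eqn_pmul2r (fact_gt0 k)) -(eqn_pmul2r (fact_gt0 l)); apply/eqP.
have h1 : 'C(n, k) * (k`! * (n - k)`!) = n`! by apply: bin_fact; lia.
have h2 : 'C(n, l) * (l`! * (n - l)`!) = n`! by apply: bin_fact; lia.
have h3 : 'C(n - k, l) * (l`! * (n - k - l)`!) = (n - k)`! by apply: bin_fact; lia.
have h4 : 'C(n - l, k) * (k`! * (n - l - k)`!) = (n - l)`! by apply: bin_fact; lia.
have e : n - l - k = n - k - l by lia.
rewrite e in h4.
move: h1 h2; rewrite -h3 -h4 => h1 h2.
move: (etrans h1 (esym h2)); lia.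
Qed.

(** Double counting of disjoint pairs: with n = [#|E|], each [A] in [H] is in exactly C(n-k, l)
    pairs and each [B] of the shadow in at most C(n-l, k). *)
Lemma local_lym E k l H :
  H \subset subsets E k -> l + k <= #|E| ->
  #|H| * 'C(#|E|, l) <= #|shadow E l H| * 'C(#|E|, k).
Proof.
move=> HE lk; set n := #|E|.
have sub A j : A \subset E -> #|[set B in subsets E j | A :&: B == set0]|
    = 'C(n - #|A|, j).
  move=> AE; have <- : #|E :\: A| = n - #|A|.
    by rewrite cardsD (setIidPr AE).
  rewrite -card_subsets; apply: eq_card => B.
  by rewrite !inE subsetD -setI_eq0 (setIC B) andbAC.
have pos : 0 < 'C(n - l, k) by rewrite bin_gt0; lia.
rewrite -(leq_pmul2r pos) -mulnA -bin_mulC_disjoint mulnA mulnAC.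
rewrite [X in _ <= X]mulnAC leq_mul2r; apply/orP; right.
have -> : #|H| * 'C(n - k, l) =
    \sum_(A in H) \sum_(B in shadow E l H | A :&: B == set0) 1.
  rewrite -sum_nat_const; apply: eq_bigr => A AH.
  have /subsetsP[AE Ak] := subsetP HE _ AH.
  rewrite -Ak -sub // -sum1_card; apply: eq_bigl => B; rewrite in_set.
  apply/andP/andP => -[Bl AB]; last by case/shadowP: Bl.
  by split=> //; apply/shadowP; split=> //; exists A => //; apply/eqP.
rewrite (exchange_big_dep (mem (shadow E l H))) /=; last by move=> A B _ /andP[].
rewrite -sum_nat_const; apply: leq_sum => B BH.
have /shadowP[/subsetsP[BE Bl] _] := BH.
rewrite -[X in 'C(n - X, _)]Bl -sub // -[X in _ <= X]sum1_card big_mkcond [X in _ <= X]big_mkcond /=.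
apply: leq_sum => A _; rewrite BH /= in_set.
case: (boolP (A \in H)) => //= AH; rewrite (subsetP HE _ AH) /=.
by rewrite setIC.
Qed.
End Uniform.

(** * Ballot walks and the reflection bound *)

Lemma bin_drop2 n k : 0 < k -> k < n ->
  'C(n, k) * (k * (n - k)) = n * (n - 1) * 'C(n - 2, k - 1).
Proof.
case: k => // k _; case: n => [|[|n]] kn; [lia|lia|].
have h1 := mul_bin_diag n.+2 k; have h2 := mul_bin_down n.+1 k.
rewrite /= in h1 h2; rewrite !subSS !subn0.
rewrite mulnA (mulnC 'C(_, _)) -h1 -mulnA [X in _ * X]mulnC -h2; lia.
Qed.

(** By [bin_drop2], C(n, a) is C(n-2, a-1) times n(n-1) / (a(n-a)), and j(n-j) <= l(n-l) since [l]
    lies between [j] and [n - j]. *)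
Lemma bin_weight_leq n j l u v : 0 < j -> j <= l -> l + j <= n ->
  u * 'C(n - 2, l - 1) <= v * 'C(n - 2, j - 1) -> u * 'C(n, l) <= v * 'C(n, j).
Proof.
move=> j0 jl ljn uv.
have pos : 0 < l * (n - l) by nia.
rewrite -(leq_pmul2r pos) -mulnA bin_drop2; [|lia|lia].
apply: (@leq_trans (v * 'C(n, j) * (j * (n - j)))).
  rewrite -[X in _ <= X]mulnA bin_drop2; [|lia|lia].
  by rewrite mulnCA [X in _ <= X]mulnCA leq_mul2l uv orbT.
by rewrite leq_mul2l; apply/orP; right; nia.
Qed.

Definition prefix_set (T : finType) (r : T -> nat) (E : {set T}) (m : nat) :=
  [set x in E | r x < m].

(* With [r] as an order on [E], the walk that goes up at members of [A] and down at
   the other points of [E] reaches height [c]. *)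
Definition hits (T : finType) (r : T -> nat) (E : {set T}) (c : nat) (A : {set T}) :=
  exists m, #|prefix_set r E m| + c <= (#|A :&: prefix_set r E m|).*2.

Section Rank.
Variables (T : finType) (r : T -> nat).
Implicit Types (E A B : {set T}) (P Q H : {set {set T}}).
Local Notation pre := (prefix_set r).
Local Notation hits := (hits r).

Lemma card_hits E c A : hits E c A -> c <= #|A|.
Proof.
case=> m hm; have := subset_leq_card (subsetIl A (pre E m)).
have := subset_leq_card (subsetIr A (pre E m)); lia.
Qed.

Lemma exists_min E : E != set0 -> exists2 z, z \in E & forall x, x \in E -> r z <= r x.
Proof.
case/set0Pn => x0 x0E; exists [arg min_(x < x0 in E) r x]; by case: arg_minnP.
Qed.

Lemma exists_max E : E != set0 -> exists2 z, z \in E & forall x, x \in E -> r x <= r z.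
Proof.
case/set0Pn => x0 x0E; exists [arg max_(x > x0 in E) r x]; by case: arg_maxnP.
Qed.

Lemma prefix_setD1 E z m : pre (E :\ z) m = pre E m :\ z.
Proof. by apply/setP => x; rewrite !inE andbA. Qed.

(** As [c] is positive, the prefix reaching height [c] contains the first point [z]. Without that
    step the walk still has to climb [c - 1] or [c + 1]. *)
Lemma hits_min E z c A : z \in E -> (forall x, x \in E -> r z <= r x) ->
  0 < c -> hits E c A ->
  if z \in A then hits (E :\ z) (c - 1) (A :\ z) else hits (E :\ z) (c + 1) A.
Proof.
move=> zE zmin c0 [m hm].
have zm : z \in pre E m.
  rewrite inE zE /= ltnNge; apply/negP => mz.
  have p0 : pre E m = set0.
    apply/setP => x; rewrite !inE; apply/negP => /andP[/zmin zx xm]; lia.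
  by move: hm; rewrite p0 setI0 cards0; lia.
have h1 := cardsD1 z (pre E m); have h2 := cardsD1 z (A :&: pre E m).
rewrite !inE in zm h2; rewrite zm andbT in h2.
rewrite inE zm in h1.
case: (boolP (z \in A)) h2 => zA /= h2; exists m.
  have e : (A :\ z) :&: pre (E :\ z) m = (A :&: pre E m) :\ z.
    by apply/setP => x; rewrite !inE; case: (x == z).
  rewrite e prefix_setD1; lia.
have e : A :&: pre (E :\ z) m = (A :&: pre E m) :\ z.
  by apply/setP => x; rewrite !inE; case: (x =P z) => //=; rewrite andbF.
rewrite e prefix_setD1; lia.
Qed.

Definition link z H := [set A :\ z | A in H & z \in A].
Definition colink z H := [set A in H | z \notin A].

Lemma linkP z H A : reflect (z \notin A /\ z |: A \in H) (A \in link z H).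
Proof.
apply: (iffP imsetP) => [[B /setIdP[BH zB] ->]|[zA AH]].
  by rewrite !inE eqxx setD1K.
exists (z |: A); first by apply/setIdP; rewrite setU11.
by rewrite setU1K.
Qed.

Lemma colinkP z H A : reflect (A \in H /\ z \notin A) (A \in colink z H).
Proof. exact: setIdP. Qed.

Lemma card_link z H : #|H| = #|link z H| + #|colink z H|.
Proof.
have -> : #|link z H| = #|[set A in H | z \in A]|.
  rewrite card_in_imset // => A B /setIdP[_ zA] /setIdP[_ zB] e.
  by rewrite -(setD1K zA) e setD1K.
rewrite -cardsUI; have -> : [set A in H | z \in A] :&: colink z H = set0.
  by apply/setP => A; rewrite !inE; case: (z \in A); rewrite ?andbF.
rewrite cards0 addn0.
by apply: eq_card => A; rewrite !inE; case: (z \in A); rewrite ?andbF ?andbT ?orbF.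
Qed.

Lemma link_uniform E z k H : H \subset subsets E k ->
  link z H \subset subsets (E :\ z) (k - 1).
Proof.
move=> HE; apply/subsetP => A /linkP[zA /(subsetP HE)/subsetsP[AE Ak]].
apply/subsetsP; split.
  rewrite subsetD1 zA andbT; apply: subset_trans AE; exact: subsetU1.
by rewrite cardsU1 zA in Ak; lia.
Qed.

Lemma colink_uniform E z k H : H \subset subsets E k ->
  colink z H \subset subsets (E :\ z) k.
Proof.
move=> HE; apply/subsetP => A /colinkP[/(subsetP HE)/subsetsP[AE Ak] zA].
by apply/subsetsP; rewrite subsetD1 zA AE.
Qed.

(** A set avoiding [z] and disjoint from [A] is disjoint from [z |: A]; a set disjoint from an [A]
    without [z] may be enlarged by [z]. The factor [(0 < l)] cancels the second term where [l - 1]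
    is truncated. *)
Lemma shadow_split E z l H : z \in E -> 
  #|shadow (E :\ z) l (link z H)| + #|shadow (E :\ z) (l - 1) (colink z H)| * (0 < l)
    <= #|shadow E l H|.
Proof.
move=> zE; rewrite (card_link z (shadow E l H)) addnC leq_add //.
  case: (posnP l) => [|l0]; first by rewrite muln0.
  rewrite muln1; apply: subset_leq_card; apply/subsetP => B.
  case/shadowP=> /subsetsP[]; rewrite subsetD1 => /andP[BE zB] Bl [A /colinkP[AH zA] AB].
  apply/linkP; split=> //; apply/shadowP; split.
    by apply/subsetsP; rewrite subUset sub1set zE BE cardsU1 zB Bl; split=> //; lia.
  exists A => //; apply/setP => x; move/setP/(_ x): AB; rewrite !inE.
  by case: (x =P z) => //= ->; rewrite (negPf zA).
apply: subset_leq_card; apply/subsetP => B.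
case/shadowP=> /subsetsP[]; rewrite subsetD1 => /andP[BE zB] Bl [A /linkP[zA AH] AB].
apply/colinkP; split=> //; apply/shadowP; split; first by apply/subsetsP.
exists (z |: A) => //; apply/setP => x; move/setP/(_ x): AB; rewrite !inE.
by case: (x =P z) => //= ->; rewrite (negPf zB).
Qed.

(* Removing the first point of [E] changes [c] by one.  The two cases have the same
   ratio of binomials up to [bin_weight_leq]; [c = 0] is the local LYM inequality. *)
Lemma hits_shadow E k c l H : H \subset subsets E k ->
  (forall A, A \in H -> hits E c A) -> k <= l + c -> l + k <= #|E| ->
  #|H| * 'C(#|E| - c, l) <= #|shadow E l H| * 'C(#|E| - c, k - c).
Proof.
move Dn: #|E| => n; elim: n E Dn k c l H => [|n IH] E Dn k c l H HE Hc klc lkn.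
all: have [->|[A0 A0H]] := set_0Vmem H; first by rewrite cards0.
all: have ck : c <= k by have /subsetsP[_ <-] := subsetP HE _ A0H; exact: card_hits (Hc _ A0H).
all: case: (posnP c) => [c0|c0]; first by rewrite c0 !subn0 -Dn; apply: local_lym; lia.
  lia.
have [z zE zmin] : exists2 z, z \in E & forall x, x \in E -> r z <= r x.
  by apply: exists_min; rewrite -cards_eq0 Dn.
have DE : #|E :\ z| = n by move: (cardsD1 z E); rewrite zE Dn; lia.
have h1 : #|link z H| * 'C(n.+1 - c, l) <=
    #|shadow (E :\ z) l (link z H)| * 'C(n.+1 - c, k - c).
  have [->|[A1 A1H]] := set_0Vmem (link z H); first by rewrite cards0.
  have k0 : 0 < k.
    have /linkP[zA1 /(subsetP HE)/subsetsP[_ <-]] := A1H.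
    by rewrite cardsU1 zA1.
  have -> : n.+1 - c = n - (c - 1) by lia.
  have -> : k - c = (k - 1) - (c - 1) by lia.
  apply: IH => //; [exact: link_uniform| |lia|lia].
  move=> A /linkP[zA AH]; have := hits_min zE zmin c0 (Hc _ AH).
  by rewrite setU11 setU1K.
have h2 : #|colink z H| * 'C(n.+1 - c, l) <=
    #|shadow (E :\ z) (l - 1) (colink z H)| * (0 < l) * 'C(n.+1 - c, k - c).
  have [->|[A1 A1H]] := set_0Vmem (colink z H); first by rewrite cards0.
  have hA A : A \in colink z H -> hits (E :\ z) (c + 1) A.
    case/colinkP=> AH zA; have := hits_min zE zmin c0 (Hc _ AH).
    by rewrite (negPf zA).
  have ck1 : c + 1 <= k.
    have /colinkP[/(subsetP HE)/subsetsP[_ <-] _] := A1H.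
    exact: card_hits (hA _ A1H).
  have -> : (0 < l) by lia.
  rewrite muln1; apply: bin_weight_leq; [lia|lia|lia|].
  have -> : n.+1 - c - 2 = n - (c + 1) by lia.
  have -> : k - c - 1 = k - (c + 1) by lia.
  by apply: IH => //; [exact: colink_uniform|lia|lia].
rewrite (card_link z H) mulnDl (leq_trans (leq_add h1 h2)) // -mulnDl.
by rewrite leq_mul2r shadow_split ?orbT.
Qed.

End Rank.

(** * Shifted cross-intersecting families *)

Definition shifted_on (T : finType) (r : T -> nat) (E : {set T}) (H : {set {set T}}) :=
  forall A x y, A \in H -> x \in E -> y \in E -> r x < r y ->
    y \in A -> x \notin A -> x |: (A :\ y) \in H.

Lemma crossC (T : finType) (P Q : {set {set T}}) : cross P Q -> cross Q P.
Proof. by move=> PQ A B AQ BP; rewrite setIC; apply: PQ. Qed.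

Section Shifted.
Variables (T : finType) (r : T -> nat).
Hypothesis r_inj : injective r.
Implicit Types (E A B : {set T}) (P Q H : {set {set T}}).

Lemma shifted_colink E z H : shifted_on r E H -> shifted_on r (E :\ z) (colink z H).
Proof.
move=> sH A x y /colinkP[AH zA] /setD1P[xz xE] /setD1P[yz yE] xy yA xA.
apply/colinkP; split; first exact: sH.
by rewrite !inE negb_or eq_sym xz (negPf zA) andbF.
Qed.

Lemma shifted_link E z H : shifted_on r E H -> shifted_on r (E :\ z) (link z H).
Proof.
move=> sH A x y /linkP[zA AH] /setD1P[xz xE] /setD1P[yz yE] xy yA xA.
apply/linkP; split; first by rewrite !inE negb_or eq_sym xz (negPf zA) andbF.
have -> : z |: (x |: A :\ y) = x |: ((z |: A) :\ y).
  apply/setP => w; rewrite !inE; case: (w =P z) => [->|]; rewrite ?orbT //=.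
  by rewrite (eq_sym z y) yz orbT.
by apply: sH => //; rewrite !inE ?negb_or ?yA ?orbT ?xz.
Qed.

Section Max.
Variables (E : {set T}) (z : T).
Hypotheses (zE : z \in E) (zmax : forall x, x \in E -> r x <= r z).

Lemma lt_max x : x \in E -> x != z -> r x < r z.
Proof.
by move=> xE xz; rewrite ltn_neqAle zmax // andbT (inj_eq r_inj).
Qed.

Lemma colink_nonempty l P : P \subset subsets E l -> shifted_on r E P ->
  l < #|E| -> P != set0 -> colink z P != set0.
Proof.
move=> PE sP lE /set0Pn[A AP]; apply/set0Pn.
case: (boolP (z \in A)) => zA; last by exists A; apply/colinkP.
have /subsetsP[AE Al] := subsetP PE _ AP.
have [x xE xA] : exists2 x, x \in E & x \notin A.
  by apply/subsetPn; apply/negP => /subset_leq_card; lia.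
have xz : x != z by apply: contraNneq xA => ->.
exists (x |: A :\ z); apply/colinkP; split.
  by apply: sP => //; exact: lt_max.
by rewrite !inE eqxx eq_sym (negPf xz).
Qed.

(** If [A] and [B] were disjoint, they and [z] would fill only 2l-1 points, so shiftedness could
    trade [z] for a free point [x]; then [x |: A] in [P] would miss [z |: B]. *)
Lemma link_cross l P Q : P \subset subsets E l -> Q \subset subsets E l ->
  shifted_on r E P -> cross P Q -> l + l <= #|E| -> cross (link z P) (link z Q).
Proof.
move=> PE QE sP PQ lE A B /linkP[zA AP] /linkP[zB BQ]; apply/negP => /eqP AB0.
have /subsetsP[AE Al] := subsetP PE _ AP; have /subsetsP[BE Bl] := subsetP QE _ BQ.
rewrite cardsU1 zA in Al; rewrite cardsU1 zB in Bl.
have [x xE] : exists2 x, x \in E & x \notin z |: (A :|: B).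
  apply/subsetPn; apply/negP => /subset_leq_card.
  by rewrite cardsU1 cardsU AB0 cards0; lia.
rewrite !inE !negb_or => /and3P[xz xA xB].
have /set0Pn[y] : (x |: (z |: A) :\ z) :&: (z |: B) != set0.
  apply: PQ BQ; apply: sP => //; first exact: lt_max.
    by rewrite setU11.
  by rewrite !inE negb_or xz.
rewrite setU1K // !inE => /andP[/orP[/eqP->|yA]].
  by rewrite (negPf xz) (negPf xB).
case/orP=> [/eqP yz|yB]; first by rewrite yz (negPf zA) in yA.
by move/setP/(_ y): AB0; rewrite !inE yA yB.
Qed.

End Max.

Lemma card_cross_single E l P B : P \subset subsets E l -> B \subset E ->
  (forall A, A \in P -> A :&: B != set0) ->
  #|P| + 'C(#|E| - #|B|, l) <= 'C(#|E|, l).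
Proof.
move=> PE BE PB.
have -> : #|E| - #|B| = #|E :\: B| by rewrite cardsD (setIidPr BE).
rewrite -!card_subsets -cardsUI.
have -> : P :&: subsets (E :\: B) l = set0.
  apply/setP => A; rewrite in_setI in_set0; apply/negP => /andP[/PB h /subsetsP[]].
  by rewrite subsetD -setI_eq0 (negPf h) andbF.
rewrite cards0 addn0; apply: subset_leq_card; rewrite subUset PE /=.
apply/subsetP => A /subsetsP[]; rewrite subsetD => /andP[AE _] Al.
exact/subsetsP.
Qed.

(** The Hilton-Milner bound for two nonempty families, by induction through the last point [z]: the
    colinks and the links are bounded separately and Pascal's rule adds the bounds. *)
Lemma card_nonempty_cross E l P Q : 
  P \subset subsets E l -> Q \subset subsets E l -> cross P Q ->
  shifted_on r E P -> shifted_on r E Q -> P != set0 -> Q != set0 ->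
  l + l <= #|E| -> #|P| + #|Q| + 'C(#|E| - l, l) <= 'C(#|E|, l) + 1.
Proof.
move Dm: #|E| => m; elim: m E Dm l P Q => [|m IH] E Dm l P Q PE QE PQ sP sQ P0 Q0 lm.
all: have l0 : 0 < l.
1,3: have [A AP] := set0Pn _ P0; have [B BQ] := set0Pn _ Q0;
     have /set0Pn[x] := PQ _ _ AP BQ; rewrite inE => /andP[xA _];
     have /subsetsP[_ <-] := subsetP PE _ AP;
     by apply/card_gt0P; exists x.
  lia.
case: (ltngtP (l + l) m.+1) lm => // lm _; last first.
  (* Here 2l = [#|E|], so the shadow of [P] at level [l] consists of the complements and is at least
     as large as [P]. *)
  have -> : m.+1 - l = l by lia.
  rewrite binn leq_add2r -Dm.
  have llE : l + l <= #|E| by lia.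
  have := local_lym PE llE; have := card_shadow_cross QE PQ.
  rewrite leq_pmul2r; [lia|rewrite bin_gt0; lia].
have [z zE zmax] : exists2 z, z \in E & forall x, x \in E -> r x <= r z.
  by apply: exists_max; rewrite -cards_eq0 Dm.
have DE : #|E :\ z| = m by move: (cardsD1 z E); rewrite zE Dm; lia.
have P0n : colink z P != set0 by apply: (colink_nonempty zE zmax PE) => //; lia.
have Q0n : colink z Q != set0 by apply: (colink_nonempty zE zmax QE) => //; lia.
have co : #|colink z P| + #|colink z Q| + 'C(m - l, l) <= 'C(m, l) + 1.
  apply: (IH (E :\ z)) => //; try exact: colink_uniform; try exact: shifted_colink.
  - by move=> A B /colinkP[AP _] /colinkP[BQ _]; exact: PQ.
suff li : #|link z P| + #|link z Q| + 'C(m - l, l - 1) <= 'C(m, l - 1).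
  rewrite (card_link z P) (card_link z Q).
  have pascal a : 'C(a.+1, l) = 'C(a, l) + 'C(a, l - 1).
    by rewrite -[in LHS](prednK l0) binS prednK // subn1.
  have -> : m.+1 - l = (m - l).+1 by lia.
  by rewrite !pascal; lia.
have one_empty P' Q' : P' \subset subsets E l -> Q' \subset subsets E l ->
    cross P' Q' -> colink z Q' != set0 ->
    #|link z P'| + 'C(m - l, l - 1) <= 'C(m, l - 1).
  move=> PE' QE' PQ' /set0Pn[B /colinkP[BQ zB]].
  have /subsetsP[BE Bl] := subsetP QE' _ BQ.
  rewrite -DE -Bl; apply: card_cross_single; first by rewrite Bl; exact: link_uniform.
    by rewrite subsetD1 BE.
  move=> A /linkP[zA AP]; have /set0Pn[x] := PQ' _ _ AP BQ.
  rewrite !inE => /andP[/orP[/eqP->|xA] xB]; first by rewrite (negPf zB) in xB.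
  by apply/set0Pn; exists x; rewrite inE xA.
have [P1|P1] := eqVneq (link z P) set0.
  by rewrite P1 cards0 add0n; apply: (one_empty Q P) => //; exact: crossC.
have [Q1|Q1] := eqVneq (link z Q) set0.
  by rewrite Q1 cards0 addn0; apply: (one_empty P Q).
have llE : l + l <= #|E| by rewrite Dm; exact: ltnW.
have c1 := link_cross zE zmax PE QE sP PQ llE.
have l1 : 1 < l.
  have [A AP] := set0Pn _ P1; have [B BQ] := set0Pn _ Q1.
  have /set0Pn[x] : A :&: B != set0 by exact: c1.
  rewrite inE => /andP[xA _].
  have := subsetP (link_uniform z PE) _ AP => /subsetsP[_ Al].
  have : 0 < #|A| by apply/card_gt0P; exists x.
  by rewrite Al subn_gt0.
have : #|link z P| + #|link z Q| + 'C(m - (l - 1), l - 1) <= 'C(m, l - 1) + 1.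
  apply: (IH (E :\ z)) => //; try exact: link_uniform; try exact: shifted_link.
  - by lia.
have -> : m - (l - 1) = (m - l).+1 by lia.
(* Both links are nonempty, and the excess 1 in the induction hypothesis is absorbed by the Pascal
   term C(m-l, l-2) >= 1. *)
have -> : l - 1 = (l - 2).+1 by lia.
rewrite binS; have : 0 < 'C(m - l, l - 2) by rewrite bin_gt0; lia.
lia.
Qed.

(** Induction on [#|A :&: B|]. If the prefix ending at the least common point [z] fails, it contains
    a point [y] outside both sets, and trading [z] for [y] in [A] makes the intersection smaller. *)
Lemma cross_prefix E P Q A B : shifted_on r E P -> cross P Q ->
  A \in P -> B \in Q -> A :&: B \subset E ->
  exists m, #|prefix_set r E m| < #|A :&: prefix_set r E m| + #|B :&: prefix_set r E m|.
Proof.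
move=> sP PQ; move Dc: #|A :&: B| => c; elim: c A Dc => [|c IH] A Dc AP BQ ABE.
  by have := PQ _ _ AP BQ; rewrite -cards_eq0 Dc.
have [z zAB zmin] : exists2 z, z \in A :&: B & forall x, x \in A :&: B -> r z <= r x.
  by apply: exists_min; rewrite -cards_eq0 Dc.
set m := (r z).+1; set X := prefix_set r E m.
case: (ltnP #|X| (#|A :&: X| + #|B :&: X|)) => [h|h]; first by exists m.
have zE := subsetP ABE _ zAB.
have /andP[zA zB] : (z \in A) && (z \in B) by rewrite -in_setI.
have zX : z \in X by rewrite inE zE leqnn.
have [y yX yAB] : exists2 y, y \in X & y \notin A :|: B.
  apply/subsetPn; apply/negP => Xsub; move: h; rewrite leqNgt => /negP; apply.
  rewrite -cardsUI -setIUl (setIidPr Xsub) -[X in X < _]addn0 ltn_add2l.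
  by apply/card_gt0P; exists z; rewrite !in_setI zA zB zX.
move: yAB; rewrite inE negb_or => /andP[yA yB].
have yz : y != z by apply: contraNneq yA => ->.
have /andP[yE] : (y \in E) && (r y < m) by move: yX; rewrite inE.
rewrite ltnS leq_eqVlt (inj_eq r_inj) (negPf yz) /= => ryz.
have AB' : (y |: A :\ z) :&: B = (A :&: B) :\ z.
  apply/setP => x; rewrite !inE; case: (x =P y) => [->|] //=.
    by rewrite (negPf yA) (negPf yB) !andbF.
  by rewrite andbA.
have [] := IH (y |: A :\ z) _ _ BQ _.
- by apply/eqP; rewrite AB' -eqSS -Dc (cardsD1 z (A :&: B)) zAB.
- exact: sP.
- by rewrite AB'; apply: subset_trans ABE; exact: subD1set.
move=> m' h'; exists m'; set Y := prefix_set r E m' in h' *.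
(* If [Y] contains [z], the trade did not increase the count of [A] in [Y]. Otherwise [Y] stops
   before [z], where the traded set and [B] are disjoint, so they cannot exceed [Y] together. *)
case: (boolP (z \in Y)) => zY.
  apply: leq_trans h' _; rewrite leq_add2r.
  apply: (@leq_trans #|y |: (A :&: Y) :\ z|).
    apply: subset_leq_card; apply/subsetP => x; rewrite !in_setI !in_setU1 !in_setD1 in_setI.
    by case: (x == y) => //=; rewrite andbA.
  by rewrite cardsU1 (cardsD1 z (A :&: Y)) in_setI zA zY; case: (_ \notin _).
exfalso; move: h'; apply/negP; rewrite -leqNgt -cardsUI -setIUl.
have -> : ((y |: A :\ z) :&: Y) :&: (B :&: Y) = set0.
  apply/setP => x; rewrite in_set0; apply/negP; rewrite !in_setI => /andP[/andP[xA xY] /andP[xB _]].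
  have : x \in (A :&: B) :\ z by rewrite -AB' in_setI xA.
  case/setD1P => _ /zmin zx; case/negP: zY.
  by move: xY; rewrite !inE zE /= => /andP[_]; exact: leq_ltn_trans.
by rewrite cards0 addn0; apply: subset_leq_card; exact: subsetIr.
Qed.

End Shifted.

(** * Numerical estimates *)

(** C(m-k, j) / C(m, j) is a product of [j] factors, the largest being (m-k)/m <= a/b. *)
Lemma bin_ratio_leq m k a b j : a <= b -> b * (m - k) <= a * m ->
  b ^ j * 'C(m - k, j) <= a ^ j * 'C(m, j).
Proof.
move=> ab; elim: j m => [|j IH] m bm; first by rewrite !bin0 !expn0.
case: m bm => [|m] bm.
  by rewrite sub0n bin0n muln0.
have h1 := mul_bin_diag m.+1 j; have h2 := mul_bin_diag (m.+1 - k) j.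
have := IH m; have -> : m - k = (m.+1 - k).-1 by lia.
rewrite /= in h1.
have bm' : b * (m.+1 - k).-1 <= a * m by nia.
move=> /(_ bm') h3.
rewrite -(leq_pmul2l (ltn0Sn j)) !(mulnCA j.+1) -h1 -h2 !expnS.
have := leq_mul bm h3; lia.
Qed.

Lemma expn_3_5 k : 8 <= k -> 4 * k * 3 ^ (k - 1) <= 5 ^ (k - 1).
Proof.
move=> k8; have -> : k = (k - 8) + 8 by lia.
elim: (k - 8) => [|d IH]; first by rewrite add0n.
have e b : b ^ (d.+1 + 8 - 1) = b * b ^ (d + 8 - 1).
  by rewrite -expnS; congr (_ ^ _); lia.
rewrite !e; nia.
Qed.

Lemma expn_3_4 k : 8 <= k -> 7 * 3 ^ (k - 1) <= 4 ^ (k - 1).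
Proof.
move=> k8; have -> : k = (k - 8) + 8 by lia.
elim: (k - 8) => [|d IH]; first by rewrite add0n.
have e b : b ^ (d.+1 + 8 - 1) = b * b ^ (d + 8 - 1).
  by rewrite -expnS; congr (_ ^ _); lia.
rewrite !e; nia.
Qed.

Lemma bin_ratio_pos m k a b c j : a <= b -> b * (m - k) <= a * m -> 0 < a ->
  c * a ^ j <= b ^ j -> c * 'C(m - k, j) <= 'C(m, j).
Proof.
move=> ab bm a0 cab; have h := bin_ratio_leq j ab bm.
have a0j : 0 < a ^ j by rewrite expn_gt0 a0.
rewrite -(leq_pmul2l a0j) (leq_trans _ h) // mulnA leq_mul2r.
by rewrite mulnC cab orbT.
Qed.

Section Numeric.
Variables n k : nat.
Hypotheses (k8 : 8 <= k) (nk : 2 * k + 1 <= n) (n4k : n <= 4 * k).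
Let N := 'C(n - 1, k - 1).
Let t := 'C(n - k - 1, k - 1).

(** Since C(n, k) = nN/k, this is C(n, k)^2 / (4 rho) <= N(N - 2t) with a factor N cancelled. *)
Lemma HM_defect_bound : n ^ 2 * (k - 1) * N <= 4 * k * (n - k) * (n - k - 1) * (N - 2 * t).
Proof.
have tE : t = 'C(n - 1 - k, k - 1) by congr 'C(_, _); lia.
(* The ratio (n-1-k)/(n-1) is at most 3/4 because n <= 4k, and at most 3/5 when 2n <= 5k. *)
have h7 : 7 * t <= N.
  by rewrite tE; apply: (@bin_ratio_pos _ _ 3 4); [|nia| |exact: expn_3_4].
have h4 : 2 * n <= 5 * k -> 4 * k * t <= N.
  by move=> n5; rewrite tE; apply: (@bin_ratio_pos _ _ 3 5); [|nia| |exact: expn_3_5].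
have [s sE] : exists s, n = 2 * k + s by exists (n - 2 * k); lia.
(* [D] is the excess of 4k(n-k)(n-k-1) over n^2(k-1) and has to absorb the term in 2t. It is small
   for [n] close to 2k, where the stronger bound 4kt <= N helps; for larger [n], 7t <= N
   suffices. *)
set D := 4 * k ^ 2 * s + (3 * k + 1) * s ^ 2.
have XY : n ^ 2 * (k - 1) + D = 4 * k * (n - k) * (n - k - 1).
  have [j jE] : exists j, k = j.+1 by exists k.-1; lia.
  have -> : n - k = k + s by lia.
  have -> : k + s - 1 = j + s by lia.
  by rewrite /D sE jE subn1 /=; ring.
suff h : 4 * k * (n - k) * (n - k - 1) * (2 * t) <= D * N.
  by rewrite [X in _ <= X]mulnBr -{1}XY [X in _ <= X - _]mulnDl -addnBA // leq_addr.
have [D1 D2] : (2 * n <= 5 * k -> 2 * (n - k) * (n - k - 1) <= D) /\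
   (5 * k < 2 * n -> 8 * k * (n - k) * (n - k - 1) <= 7 * D).
  rewrite /D; have -> : n - k = k + s by lia.
  split=> [_|n5].
    have [u uE] : exists u, s = u.+1 by exists s.-1; lia.
    have -> : k + s - 1 = k + u by lia.
    rewrite uE -(leq_add2r (u ^ 2)).
    apply: (@leq_trans (2 * (k + u.+1) * (k + u) + 3 * k * u ^ 2)).
      by rewrite leq_add2l leq_pmull //; lia.
    apply: leq_trans (leq_addr (2 * k ^ 2 + k + 2 * k * u + 4 * k ^ 2 * u + 1) _) _.
    by apply: eq_leq; ring.
  apply: (@leq_trans (k * (8 * (k + s) ^ 2))).
    have le : k + s - 1 <= k + s by lia.
    apply: (@leq_trans (8 * k * (k + s) * (k + s))); first by rewrite leq_mul2l le orbT.
    by apply: eq_leq; ring.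
  have a1 : k * k <= k * (2 * s) by rewrite leq_mul2l; lia.
  have a2 : k * s <= 2 * s * s by rewrite leq_mul2r; lia.
  apply: (@leq_trans (k * (28 * k * s + 21 * s ^ 2))).
    rewrite leq_mul2l; apply/orP; right; lia.
  apply: (@leq_trans (k * (28 * k * s + 21 * s ^ 2) + 7 * s ^ 2)); first exact: leq_addr.
  by apply: eq_leq; ring.
case: (leqP (2 * n) (5 * k)) => n5.
  have := leq_mul (D1 n5) (h4 n5); lia.
have := leq_mul (D2 n5) h7; lia.
Qed.
End Numeric.

Definition HM_bound n k := 'C(n - 1, k - 1) - 'C(n - k - 1, k - 1) + 1.

Lemma amgm x y s : x + y <= s + s -> x * y <= s * s.
Proof.
move=> xy; rewrite -(leq_pmul2l (_ : 0 < 4)) //.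
apply: (@leq_trans ((x + y) ^ 2)); first exact: nat_AGM2.
by apply: (@leq_trans ((s + s) ^ 2)); [rewrite leq_exp2r|apply: eq_leq; ring].
Qed.

(** The assumption reads rho x + y <= C(n, k) with rho = [R] / [S]. AM-GM and [HM_defect_bound] give
    xy <= N(N - 2t) <= (N - t)^2. *)
Lemma product_HM_bound n k x y : 8 <= k -> 2 * k + 1 <= n -> n <= 4 * k ->
  x * 'C(n - 2, k) <= ('C(n, k) - y) * 'C(n - 2, k - 2) -> y <= 'C(n, k) ->
  x * y <= HM_bound n k ^ 2.
Proof.
move=> k8 nk n4k; set M := 'C(n, k); set R := 'C(n - 2, k); set S := 'C(n - 2, k - 2).
set N := 'C(n - 1, k - 1) => xR yM.
have S0 : 0 < S by rewrite bin_gt0; lia.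
have RS : R * (k * (k - 1)) = S * ((n - k) * (n - k - 1)).
  have h1 : k * R = (n - k - 1) * 'C(n - 2, k - 1).
    have e : (k - 1).+1 = k by lia.
    by have := mul_bin_left (n - 2) (k - 1); rewrite e => ->; congr (_ * _); lia.
  have h2 : (k - 1) * 'C(n - 2, k - 1) = (n - k) * S.
    have e : (k - 2).+1 = k - 1 by lia.
    by have := mul_bin_left (n - 2) (k - 2); rewrite e => ->; congr (_ * _); lia.
  by rewrite mulnA (mulnC R) h1 mulnAC -mulnA h2; ring.
have MN : k * M = n * N.
  have := mul_bin_diag n (k - 1); rewrite -!subn1 => ->; congr (_ * 'C(_, _)); lia.
have h4 : 4 * (x * y) * R <= M ^ 2 * S.
  rewrite -(leq_pmul2r S0).
  have -> : 4 * (x * y) * R * S = 4 * ((x * R) * (y * S)) by ring.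
  apply: leq_trans (nat_AGM2 _ _) _.
  have -> : M ^ 2 * S * S = (M * S) ^ 2 by ring.
  rewrite leq_exp2r //.
  apply: leq_trans (leq_add xR (leqnn _)) _.
  by rewrite -mulnDl subnK.
set a := (n - k) * (n - k - 1) in RS.
have h5 : 4 * (x * y) * a <= M ^ 2 * (k * (k - 1)).
  rewrite -(leq_pmul2r S0).
  have -> : 4 * (x * y) * a * S = 4 * (x * y) * R * (k * (k - 1)).
    by rewrite -[RHS]mulnA RS; ring.
  have -> : M ^ 2 * (k * (k - 1)) * S = M ^ 2 * S * (k * (k - 1)) by ring.
  by rewrite leq_mul2r h4 orbT.
have h6 := HM_defect_bound k8 nk n4k.
rewrite -/N in h6; set t := 'C(n - k - 1, k - 1) in h6.
have pos : 0 < 4 * k * a by rewrite /a; nia.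
have h7 : x * y <= (N - 2 * t) * N.
  rewrite -(leq_pmul2l pos).
  have -> : 4 * k * a * (x * y) = k * (4 * (x * y) * a) by ring.
  apply: (@leq_trans (k * (M ^ 2 * (k * (k - 1))))); first by rewrite leq_mul2l h5 orbT.
  have -> : k * (M ^ 2 * (k * (k - 1))) = (k * M) ^ 2 * (k - 1) by ring.
  rewrite MN.
  have -> : (n * N) ^ 2 * (k - 1) = n ^ 2 * (k - 1) * N * N by ring.
  have -> : 4 * k * a * ((N - 2 * t) * N) = 4 * k * (n - k) * (n - k - 1) * (N - 2 * t) * N.
    by rewrite /a !mulnA.
  by rewrite leq_mul2r h6 orbT.
apply: leq_trans h7 _; rewrite /HM_bound -/N -/t -mulnn.
apply: (@leq_trans ((N - t) * (N - t))); last by apply: leq_mul; exact: leq_addr.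
by apply: amgm; clearbody N t; lia.
Qed.

(** * Product bounds from ballot conditions *)

Section Product.
Variables (T : finType) (r : T -> nat).
Implicit Types (E A B : {set T}) (F G : {set {set T}}).

Lemma product_of_hits k F G : 8 <= k -> 2 * k + 1 <= #|T| -> #|T| <= 4 * k ->
  F \subset subsets [set: T] k -> G \subset subsets [set: T] k -> cross F G ->
  (forall A, A \in F -> hits r [set: T] 2 A) ->
  #|F| * #|G| <= HM_bound #|T| k ^ 2.
Proof.
move=> k8 nk n4k FT GT FG Fh.
have c1 := card_shadow_cross GT FG; rewrite cardsT in c1.
have c2 : #|F| * 'C(#|T| - 2, k) <= #|shadow [set: T] k F| * 'C(#|T| - 2, k - 2).
  by rewrite -cardsT; apply: (hits_shadow (r := r)) => //; rewrite ?cardsT; lia.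
apply: product_HM_bound => //; last by apply: leq_trans c1; exact: leq_addl.
apply: leq_trans c2 _; rewrite leq_mul2r; apply/orP; right.
by rewrite leq_subRL ?(leq_trans _ c1) ?leq_addl // addnC.
Qed.

Hypothesis r_inj : injective r.
Variables (i j : T).
Hypothesis ij : i != j.
Let E := [set: T] :\ i :\ j.

(** The links are paired across the families: F(i) with G(j), F(j) with G(i), F(ij) with G(0), F(0)
    with G(ij). The four bounds add up to twice [HM_bound]. *)
Lemma product_of_shifted k F G : 8 <= k -> 2 * k + 1 <= #|T| ->
  F \subset subsets [set: T] k -> G \subset subsets [set: T] k -> cross F G ->
  shifted_on r E F -> shifted_on r E G ->
  colink j (link i F) != set0 -> link j (colink i F) != set0 ->
  colink j (link i G) != set0 -> link j (colink i G) != set0 ->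
  (forall A, A \in colink j (colink i F) -> hits r E 2 A) ->
  (forall A, A \in colink j (colink i G) -> hits r E 2 A) ->
  #|F| * #|G| <= HM_bound #|T| k ^ 2.
Proof.
move=> k8 nk FT GT FG sF sG Fi Fj Gi Gj Fh Gh.
set n := #|T| in nk *.
have e1 : n - 2 - (k - 1) = n - k - 1 by lia.
have e2 : (k - 1) + (k - 1) <= n - 2 by lia.
have e3 : 0 < 'C(n - 2 - 2, k - 2) by rewrite bin_gt0; lia.
have e4 : k <= k - 2 + 2 by lia.
have e5 : k - 2 + k <= n - 2 by lia.
have e6 : 'C(n - 1, k - 1) = 'C(n - 2, k - 1) + 'C(n - 2, k - 2).
  have -> : n - 1 = (n - 2).+1 by lia.
  have e : k - 1 = (k - 2).+1 by lia.
  by rewrite e binS.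
have e7 : 'C(n - k - 1, k - 1) <= 'C(n - 2, k - 1) by apply: leq_bin2l; lia.
have En : #|E| = n - 2.
  have := cardsD1 i [set: T]; have := cardsD1 j ([set: T] :\ i).
  by rewrite !inE eq_sym ij cardsT /= -/n -/E => -> ->; lia.
have sub (H : {set {set T}}) : H \subset subsets [set: T] k ->
    [/\ link j (link i H) \subset subsets E (k - 2),
        colink j (link i H) \subset subsets E (k - 1),
        link j (colink i H) \subset subsets E (k - 1) &
        colink j (colink i H) \subset subsets E k].
  move=> HT; have l1 := link_uniform i HT; have c1 := colink_uniform i HT.
  split; try exact: colink_uniform; try exact: link_uniform.
  by have := link_uniform j l1; rewrite -subnDA.
have shd (H : {set {set T}}) : shifted_on r E H ->
    shifted_on r E (colink j (link i H)) /\ shifted_on r E (link j (colink i H)).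
  have Ei : E :\ i = E by apply/setP => x; rewrite !inE; case: (x == i); rewrite ?andbF.
  have Ej : E :\ j = E by apply/setP => x; rewrite !inE; case: (x == j).
  move=> sH; have l1 := shifted_link (z := i) sH; have c1 := shifted_colink (z := i) sH.
  rewrite Ei in l1 c1; split; rewrite -Ej; [exact: shifted_colink|exact: shifted_link].
have [F2 F1 F1' F0] := sub _ FT; have [G2 G1 G1' G0] := sub _ GT.
have [sF1 sF1'] := shd _ sF; have [sG1 sG1'] := shd _ sG.
have disj (H H' : {set {set T}}) : cross H H' -> cross (link j (link i H)) (colink j (colink i H')) /\
     cross (colink j (link i H)) (link j (colink i H')).
  move=> HH; split=> A B.
    move=> /linkP[jA /linkP[iA AH]] /colinkP[/colinkP[BH iB] jB].
    have /set0Pn[x] := HH _ _ AH BH; rewrite !inE => /andP[/or3P[/eqP->|/eqP->|xA] xB].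
    - by rewrite (negPf iB) in xB.
    - by rewrite (negPf jB) in xB.
    - by apply/set0Pn; exists x; rewrite inE xA.
  move=> /colinkP[/linkP[iA AH] jA] /linkP[jB /colinkP[BH iB]].
  have /set0Pn[x] := HH _ _ AH BH; rewrite !inE in iB *.
  move: iB; rewrite negb_or (negPf ij) /= => iB.
  case/andP=> /orP[/eqP->|xA] /orP[/eqP xj|xB].
  - by case/eqP: ij.
  - by rewrite (negPf iB) in xB.
  - by rewrite -xj xA in jA.
  - by apply/set0Pn; exists x; rewrite inE xA.
have [d1 d2] := disj _ _ FG; have [d3 d4] := disj _ _ (crossC FG).
have mid (P Q : {set {set T}}) : P \subset subsets E (k - 1) -> Q \subset subsets E (k - 1) ->
    cross P Q -> shifted_on r E P -> shifted_on r E Q -> P != set0 -> Q != set0 ->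
    #|P| + #|Q| + 'C(n - k - 1, k - 1) <= 'C(n - 2, k - 1) + 1.
  move=> PE QE PQ sP sQ P0 Q0.
  have := card_nonempty_cross r_inj PE QE PQ sP sQ P0 Q0; rewrite En e1; exact.
have out (P Q : {set {set T}}) : P \subset subsets E (k - 2) -> Q \subset subsets E k ->
    cross P Q -> (forall A, A \in Q -> hits r E 2 A) -> #|P| + #|Q| <= 'C(n - 2, k - 2).
  move=> PE QE PQ Qh; have := card_shadow_cross PE (crossC PQ).
  (* For c = 2 and l = k-2 both binomials of [hits_shadow] are C(n-4, k-2) and cancel. *)
  have := hits_shadow (l := k - 2) QE Qh.
  rewrite En leq_pmul2r //.
  by move=> /(_ e4 e5) h1 h2; rewrite addnC; apply: leq_trans h2; rewrite leq_add2r.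
have m1 := mid _ _ F1 G1' d2 sF1 sG1' Fi Gj.
have m2 := mid _ _ G1 F1' d4 sG1 sF1' Gi Fj.
have o1 := out _ _ F2 G0 d1 Gh; have o2 := out _ _ G2 F0 d3 Fh.
rewrite -mulnn; apply: amgm.
rewrite (card_link i F) (card_link i G) (card_link j (link i F)) (card_link j (colink i F)).
rewrite (card_link j (link i G)) (card_link j (colink i G)) /HM_bound.
rewrite e6.
have arith a b c d a' b' c' d' p q t : b + c' + t <= p + 1 -> b' + c + t <= p + 1 ->
    a + d' <= q -> a' + d <= q -> t <= p ->
    a + b + (c + d) + (a' + b' + (c' + d')) <= p + q - t + 1 + (p + q - t + 1).
  by clear; lia.
exact: arith m1 m2 o1 o2 e7.
Qed.

End Product.

(** * The shift operation *)

Definition shift_set (T : finType) (i j : T) (F : {set {set T}}) (A : {set T}) :=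
  if [&& j \in A, i \notin A & i |: (A :\ j) \notin F] then i |: (A :\ j) else A.

Definition shift (T : finType) (i j : T) (F : {set {set T}}) : {set {set T}} :=
  [set shift_set i j F A | A in F].

Section Shift.
Variables (T : finType) (i j : T).
Implicit Types (A B : {set T}) (F G : {set {set T}}).

Variant shift_set_spec F A : {set T} -> Type :=
| ShiftMoved of j \in A & i \notin A & i |: (A :\ j) \notin F :
    shift_set_spec F A (i |: (A :\ j))
| ShiftFixed of (j \in A -> i \notin A -> i |: (A :\ j) \in F) :
    shift_set_spec F A A.

Lemma shift_setP F A : shift_set_spec F A (shift_set i j F A).
Proof.
rewrite /shift_set; case: ifP => [/and3P[]|h]; first exact: ShiftMoved.
by apply: ShiftFixed => jA iA; move: h; rewrite jA iA /= => /negbFE.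
Qed.

Lemma shift_set_mem F A x : x != i -> x != j -> (x \in shift_set i j F A) = (x \in A).
Proof. by move=> xi xj; case: shift_setP => // *; rewrite !inE (negPf xi) xj. Qed.

Lemma mem_shift F A : A \in F -> shift_set i j F A \in shift i j F.
Proof. exact: imset_f. Qed.

Lemma shift_stable F A : shift i j F = F -> A \in F -> j \in A -> i \notin A ->
  i |: (A :\ j) \in F.
Proof.
move=> sF AF jA iA; have := mem_shift AF; rewrite sF.
by case: shift_setP => // h; rewrite h.
Qed.

Lemma shift_setK A : j \in A -> i \notin A -> j |: ((i |: (A :\ j)) :\ i) = A.
Proof. by move=> jA iA; rewrite setU1K ?setD1K // !inE (negPf iA) andbF. Qed.

Lemma shift_set_inj F : {in F &, injective (shift_set i j F)}.
Proof.
move=> A B AF BF; case: shift_setP => [jA iA mA|fA]; case: shift_setP => [jB iB mB|fB] //.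
- by move=> e; rewrite -(shift_setK jA iA) e shift_setK.
- by move=> e; rewrite e BF in mA.
- by move=> e; rewrite -e AF in mB.
Qed.

Lemma card_shift F : #|shift i j F| = #|F|.
Proof. exact: card_in_imset (@shift_set_inj F). Qed.

Lemma shift_uniform k F : F \subset subsets [set: T] k -> shift i j F \subset subsets [set: T] k.
Proof.
move=> FT; apply/subsetP => _ /imsetP[A AF ->].
have /subsetsP[_ Ak] := subsetP FT _ AF; apply/subsetsP; split=> //.
case: shift_setP => // jA iA _; rewrite cardsU1 !inE (negPf iA) andbF /=.
by rewrite -Ak (cardsD1 j A) jA.
Qed.

(** The delicate case is a moved [C] against a fixed [D] containing [j] but not [i]: the replacement
    of [D] is already in its family and meets [C] in a point other than [i] and [j], which [D]
    shares. *)
Lemma shift_cross F G : cross F G -> cross (shift i j F) (shift i j G).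
Proof.
move=> FG _ _ /imsetP[A AF ->] /imsetP[B BG ->].
have move1 (P Q : {set {set T}}) (C D : {set T}) : cross P Q -> C \in P -> D \in Q ->
    j \in C -> i \notin C -> (j \in D -> i \notin D -> i |: (D :\ j) \in Q) ->
    (i |: (C :\ j)) :&: D != set0.
  move=> PQ CP DQ jC iC fD; apply/set0Pn.
  have [iD|iD] := boolP (i \in D); first by exists i; rewrite !inE eqxx iD.
  have [jD|jD] := boolP (j \in D).
    have /set0Pn[x] := PQ _ _ CP (fD jD iD); rewrite !inE => /andP[xC].
    case/orP=> [/eqP xi|/andP[xj xD]]; first by rewrite -xi xC in iC.
    by exists x; rewrite !inE xj xC xD orbT.
  have /set0Pn[x] := PQ _ _ CP DQ; rewrite inE => /andP[xC xD].
  by exists x; rewrite !inE xC xD andbT (_ : x != j) ?orbT //; apply: contraNneq jD => <-.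
case: shift_setP => [jA iA _|fA]; case: shift_setP => [jB iB _|fB].
- by apply/set0Pn; exists i; rewrite !inE eqxx.
- exact: move1 FG AF BG jA iA fB.
- by rewrite setIC; exact: move1 (crossC FG) BG AF jB iB fA.
- exact: FG.
Qed.

End Shift.

Lemma shifted_on_stable (T : finType) (r : T -> nat) (E : {set T}) (H : {set {set T}}) :
  (forall x y, x \in E -> y \in E -> r x < r y -> shift x y H = H) -> shifted_on r E H.
Proof. by move=> sH A x y AH xE yE xy yA xA; apply: shift_stable => //; exact: sH. Qed.

(** * A weight that measures progress *)

Section Weight.
Variable n : nat.
Implicit Types (A B : {set 'I_n}) (F G : {set {set 'I_n}}).

(** Smaller elements weigh more, so an effective shift to the left increases [Weight]. The successor
    makes even the empty set count, so that adding any set does too. *)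
Definition weight A := (\sum_(x in A) (n - x)).+1.
Definition Weight F := \sum_(A in F) weight A.

Lemma weight_shift_set (i j : 'I_n) F A : i < j ->
  weight A <= weight (shift_set i j F A) ?= iff (shift_set i j F A == A).
Proof.
move=> ij; case: shift_setP => [jA iA _|_]; last by rewrite eqxx; apply/leqif_refl.
have iA' : i \notin A :\ j by rewrite inE (negPf iA) andbF.
apply/leqifP; case: eqP => [e|_]; first by move: iA; rewrite -e setU11.
rewrite ltnS /weight (big_setD1 j) //= big_setU1 //= ltn_add2r.
by have := ltn_ord j; lia.
Qed.

Lemma Weight_shift (i j : 'I_n) F : i < j -> Weight F <= Weight (shift i j F) ?= iff (shift i j F == F).
Proof.
move=> ij; rewrite {2}/Weight big_imset /=; last exact: shift_set_inj.
have := leqif_sum (fun A (_ : A \in F) => weight_shift_set F A ij).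
congr (_ <= _ ?= iff _); apply/forall_inP/eqP => [h|e A AF].
  apply/setP => B; apply/imsetP/idP => [[A AF ->]|BF].
    by rewrite (eqP (h _ AF)).
  by exists B; rewrite ?(eqP (h _ BF)).
case: shift_setP => // jA iA; rewrite -e => /negP[].
by rewrite e; apply: shift_stable.
Qed.

Lemma Weight_max F : Weight F <= Weight setT.
Proof.
rewrite /Weight [X in _ <= X](bigID (mem F)) /= -[X in X <= _]addn0 leq_add //.
by apply: eq_leq; apply: eq_bigl => A; rewrite !inE.
Qed.

Lemma Weight_setU1 A F : A \notin F -> Weight F < Weight (A |: F).
Proof. by move=> AF; rewrite /Weight big_setU1 //= -[X in X < _]add0n ltn_add2r. Qed.

End Weight.

Lemma links_nonempty (T : finType) (i j : T) (F : {set {set T}}) : i != j ->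
  (exists2 A, A \in F & (i \in A) && (j \notin A)) ->
  (exists2 A, A \in F & (j \in A) && (i \notin A)) ->
  colink j (link i F) != set0 /\ link j (colink i F) != set0.
Proof.
move=> ij [A AF /andP[iA jA]] [B BF /andP[jB iB]]; split; apply/set0Pn.
  exists (A :\ i); apply/colinkP; split; last by rewrite !inE (negPf jA) andbF.
  by apply/linkP; rewrite setD1K // !inE eqxx.
exists (B :\ j); apply/linkP; split; first by rewrite !inE eqxx.
by rewrite setD1K //; apply/colinkP.
Qed.

(** * Ballot sets versus a bad set *)

Section Main.
Variables (n k : nat).
Hypotheses (k8 : 8 <= k) (nk : 2 * k + 1 <= n) (n4k : n <= 4 * k).
Implicit Types (A B : {set 'I_n}) (F G : {set {set 'I_n}}).

Local Notation uniform F := (F \subset subsets [set: 'I_n] k).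
Let val_n : 'I_n -> nat := val.

Lemma product_of_hits_ord (r : 'I_n -> nat) F G : uniform F -> uniform G -> cross F G ->
  (forall A, A \in F -> hits r [set: 'I_n] 2 A) -> #|F| * #|G| <= HM_bound n k ^ 2.
Proof. by move=> FT GT FG h; have := product_of_hits k8 _ _ FT GT FG h; rewrite card_ord; apply. Qed.

(** A member that is not a ballot set has a walk that never rises above height 1. The split is
    classical because [hits] quantifies over all [m]. *)
Lemma hits_or_bad (E : {set 'I_n}) F :
  (forall A, A \in F -> hits val_n E 2 A) \/
  exists2 A, A \in F & forall m,
    (#|A :&: prefix_set val_n E m|).*2 <= #|prefix_set val_n E m| + 1.
Proof.
case: (classic (exists2 A, A \in F & ~ hits val_n E 2 A)) => [[A AF nA]|nex].
  right; exists A => // m; rewrite leqNgt; apply/negP => h; apply: nA; exists m.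
  by move: h; rewrite addn1 addn2.
left=> A AF; apply: NNPP => nA; apply: nex; by exists A.
Qed.

(** * A shift that creates a star *)

Section Pair.
Variables (i j : 'I_n).
Hypothesis ij : i < j.
Let E := [set: 'I_n] :\ i :\ j.

Lemma neq_ij : i != j.
Proof. by apply: contraTneq ij => ->; rewrite ltnn. Qed.

Lemma mem_outside x : (x \in E) = (x != j) && (x != i).
Proof. by rewrite !inE andbT. Qed.

(** The order puts [i] first, [E] next and [j] last; the value [n.+1] keeps [j] out of the prefixes
    used below. *)
Definition rank_ij (x : 'I_n) := if x == i then 0 else if x == j then n.+1 else x.+1.

(** Together [A] and [B] exceed some prefix of [E], while the walk of [B] stays at height at most 1
    there. So the walk of [A] has height at least 1, and the leading [i] adds one more. *)
Lemma hits_rank_ij F G A B : shifted_on val_n E F -> cross F G -> A \in F -> B \in G ->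
  i \in A -> i \notin B -> j \notin B ->
  (forall m, (#|B :&: prefix_set val_n E m|).*2 <= #|prefix_set val_n E m| + 1) ->
  hits rank_ij [set: 'I_n] 2 A.
Proof.
move=> sF FG AF BG iA iB jB bad.
have ABE : A :&: B \subset E.
  apply/subsetP => x; rewrite inE mem_outside => /andP[_ xB].
  by apply/andP; split; [apply: contraNneq jB => <-|apply: contraNneq iB => <-].
have [m] := cross_prefix val_inj sF FG AF BG ABE.
(* Cutting [m] at [n] loses no point of [E] and keeps [j] outside the prefix for [rank_ij]. *)
have -> : prefix_set val E m = prefix_set val_n E (minn m n).
  by apply/setP => x; rewrite !inE leq_min ltn_ord !andbT.
set m' := minn m n; have mn : m' <= n by exact: geq_minr.
set X := prefix_set val_n E m'; have := bad m'; rewrite -/X => hB hAB.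
exists m'.+1.
have -> : prefix_set rank_ij [set: 'I_n] m'.+1 = i |: X.
  apply/setP => x; rewrite !inE /rank_ij /=; case: (x =P i) => [->|_] //=.
  by case: (x =P j) => //= _; rewrite ltnS; apply/negbTE; rewrite -leqNgt.
have iX : i \notin X by rewrite !inE eqxx andbF.
have -> : A :&: (i |: X) = i |: (A :&: X).
  by apply/setP => x; rewrite !inE; case: (x =P i) => [->|] //=; rewrite iA.
have arith a b p : b.*2 <= p + 1 -> p < a + b -> 1 + p + 2 <= (1 + a).*2 by lia.
by rewrite !cardsU1 iX in_setI (negPf iX) andbF; exact: arith hB hAB.
Qed.

Lemma link_mem_outside F x y A : x \in E -> y \in E ->
  ((i \in shift_set x y F A) = (i \in A)) * ((j \in shift_set x y F A) = (j \in A)).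
Proof.
rewrite !mem_outside => /andP[xj xi] /andP[yj yi].
by split; rewrite shift_set_mem // eq_sym.
Qed.

Definition meets_differently F :=
  (exists2 A, A \in F & (i \in A) && (j \notin A)) /\
  (exists2 A, A \in F & (j \in A) && (i \notin A)).

Lemma meets_differently_shift F x y : x \in E -> y \in E ->
  meets_differently F -> meets_differently (shift x y F).
Proof.
move=> xE yE [[A AF hA] [B BF hB]].
by split; [exists (shift_set x y F A)|exists (shift_set x y F B)];
  rewrite ?mem_shift ?link_mem_outside.
Qed.

(* [F'] and [G'] stand for the images of [F] and [G] under the shift j -> i. *)
Lemma product_of_cover F G F' G' :
  uniform F -> uniform G -> uniform F' -> uniform G' -> cross F G -> cross F' G' ->
  (forall A, A \in F -> (i \in A) || (j \in A)) -> (forall A, A \in F' -> i \in A) ->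
  (forall B, B \in G -> i \notin B -> j \notin B -> B \in G') ->
  #|F'| = #|F| -> #|G'| = #|G| -> meets_differently F -> meets_differently G ->
  #|F| * #|G| <= HM_bound n k ^ 2.
Proof.
have [w] := ubnP (Weight [set: {set 'I_n}] - Weight F + (Weight [set: {set 'I_n}] - Weight G)
   + (Weight [set: {set 'I_n}] - Weight F') + (Weight [set: {set 'I_n}] - Weight G')).
elim: w F G F' G' => // w IH F G F' G' hw uF uG uF' uG' FG FG' cF cF' GG' eF eG dF dG.
pose moved x y := [|| shift x y F != F, shift x y G != G, shift x y F' != F' | shift x y G' != G'].
case: (boolP [exists x in E, exists y in E, (x < y) && moved x y]).
  case/exists_inP => x xE /exists_inP[y yE /andP[xy mv]].
  rewrite -(card_shift x y F) -(card_shift x y G).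
  apply: (IH _ _ (shift x y F') (shift x y G')); rewrite ?card_shift //;
    try exact: shift_uniform; try exact: shift_cross; try exact: meets_differently_shift.
  - have incr H := Weight_shift H xy; have top (H : {set {set 'I_n}}) := Weight_max H.
    have lt H : shift x y H != H -> Weight H < Weight (shift x y H).
      by rewrite (ltn_leqif (incr H)).
    have le H : Weight H <= Weight (shift x y H) by case: (incr H).
    have arith W a b c d a' b' c' d' : W - a + (W - b) + (W - c) + (W - d) < w.+1 ->
        a <= a' <= W -> b <= b' <= W -> c <= c' <= W -> d <= d' <= W ->
        [|| a < a', b < b', c < c' | d < d'] ->
        W - a' + (W - b') + (W - c') + (W - d') < w.
      by clear; lia.
    apply: arith hw _ _ _ _ _; rewrite ?le ?top //.
    by case/or4P: mv => /lt ->; rewrite ?orbT.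
  - by move=> _ /imsetP[A AF ->]; rewrite !link_mem_outside // cF.
  - by move=> _ /imsetP[A AF ->]; rewrite !link_mem_outside // cF'.
  - move=> _ /imsetP[B BG ->]; rewrite !link_mem_outside // => iB jB.
    have BG' := GG' _ BG iB jB.
    (* If [G] moves [B], then [G'] moves it too or already has the new set. If [G] keeps [B] because
       the new set is in [G], that set avoids [i] and [j] as well, so it is in [G'], which keeps [B]
       too. *)
    case: shift_setP => [yB xB nB|fB].
      have := mem_shift x y BG'; case: shift_setP => // h1 _.
      have nn := h1 yB xB; have := mem_shift x y nn.
      by rewrite /shift_set setU11 andbF.
    have := mem_shift x y BG'; case: shift_setP => // yB xB /negP[].
    apply: GG' (fB yB xB) _ _; move: xE yE; rewrite !mem_outside => /andP[xj xi] /andP[yj yi].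
      by rewrite !inE negb_or eq_sym xi (negPf iB) andbF.
    by rewrite !inE negb_or eq_sym xj (negPf jB) andbF.
move=> stable.
have fixed H : H \in [:: F; G; F'; G'] -> shifted_on val_n E H.
  move=> HH; apply: shifted_on_stable => x y xE yE xy; apply/eqP/negPn/negP => mv.
  case/negP: stable; apply/exists_inP; exists x => //; apply/exists_inP; exists y => //.
  rewrite xy /moved; move: HH mv; rewrite !inE.
  by case/or4P => /eqP -> ->; rewrite ?orbT.
(* A bad [Y] in [G] also lies in [G'] and turns the whole star [F'] into ballot sets; the sizes
   agree, so bounding the product for [F'] and [G'] is enough. *)
have [badG|[Y]] := hits_or_bad E (colink j (colink i G)); last first.
  case/colinkP=> /colinkP[YG iY] jY bad; rewrite -eF -eG.
  apply: (product_of_hits_ord (r := rank_ij)) => // A AF'.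
  apply: (hits_rank_ij (fixed F' _) FG' AF' (GG' _ YG iY jY)) => //; last exact: cF'.
  by rewrite !inE eqxx !orbT.
have [F1 F2] := links_nonempty neq_ij dF.1 dF.2.
have [G1 G2] := links_nonempty neq_ij dG.1 dG.2.
rewrite -[X in HM_bound X](card_ord n).
apply: (product_of_shifted val_inj neq_ij) => //; rewrite ?card_ord //.
- by apply: fixed; rewrite inE eqxx.
- by apply: fixed; rewrite !inE eqxx orbT.
(* [F] is covered by the pair, so F(0) is empty. *)
- move=> A /colinkP[/colinkP[/cF]]; by move=> /orP[->|->].
Qed.

Definition nontriv F := [forall c, [exists A in F, c \notin A]].

Lemma nontrivP F : reflect (forall c, exists2 A, A \in F & c \notin A) (nontriv F).
Proof.
apply: (iffP forallP) => h c; first by have /exists_inP := h c.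
by apply/exists_inP.
Qed.

(** The common point after the shift can only be [i], so every member of [F] without [i] contains
    [j] and is moved. Saturation supplies the members of [G] that separate [i] from [j]. *)
Lemma product_of_trivial_shift F G :
  uniform F -> uniform G -> cross F G -> nontriv F ->
  (forall A, A \in subsets [set: 'I_n] k -> (forall B, B \in G -> A :&: B != set0) -> A \in F) ->
  ~~ nontriv (shift i j F) -> #|F| * #|G| <= HM_bound n k ^ 2.
Proof.
move=> uF uG FG /nontrivP ntF satF; rewrite negb_forall => /existsP[c].
rewrite negb_exists => /forallP hc.
have star A : A \in F -> c \in shift_set i j F A.
  by move=> AF; have := hc (shift_set i j F A); rewrite mem_shift // negbK.
have ci : c = i.
  apply/eqP/negPn/negP => ci; have [A AF cA] := ntF c; have := star _ AF.
  case: shift_setP => [jA iA _|_]; last by rewrite (negPf cA).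
  by rewrite !inE (negPf ci) (negPf cA) andbF.
subst c.
have moved A : A \in F -> i \notin A -> j \in A /\ i |: (A :\ j) \notin F.
  by move=> AF iA; have := star _ AF; case: shift_setP => //; rewrite (negPf iA).
have sub A B x : A \in F -> B \in G -> (x \in A -> x \notin B) ->
   forall y, (y |: (A :\ x)) :&: B != set0.
  move=> AF BG xB y; have /set0Pn[z] := FG _ _ AF BG; rewrite inE => /andP[zA zB].
  apply/set0Pn; exists z; rewrite !inE zA zB andbT orbC (_ : z != x) //.
  by apply: contraTneq zB => zx; rewrite zx in zA *; exact: xB.
(* By saturation, a set missing from [F] is disjoint from some [B] in [G]; as [B] meets [A], it must
   contain [x]. *)
have swap A x y : A \in F -> x \in A -> y \notin A -> y |: (A :\ x) \notin F ->
    exists2 B, B \in G & (x \in B) && (y \notin B).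
  move=> AF xA yA nF.
  have [B] : exists2 B, B \in G & (y |: (A :\ x)) :&: B == set0.
    apply/exists_inP; apply: contraR nF; rewrite negb_exists_in => /forall_inP h.
    apply: satF => //; have /subsetsP[_ Ak] := subsetP uF _ AF.
    apply/subsetsP; rewrite subsetT cardsU1 !inE (negPf yA) andbF; split=> //.
    by rewrite -Ak (cardsD1 x A) xA.
  move=> BG /eqP nB; exists B => //; apply/andP; split.
    by apply: contraT => xB; have := sub _ _ x AF BG (fun _ => xB) y; rewrite nB eqxx.
  by apply/negP => yB; move/setP/(_ y): nB; rewrite !inE eqxx yB.
have [Aj AjF iAj] := ntF i; have [jAj Aj'] := moved _ AjF iAj.
have [Ai AiF jAi] := ntF j.
have iAi : i \in Ai by apply: contraT => iAi; have [] := moved _ AiF iAi; rewrite (negPf jAi).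
(* Otherwise this would be a member without [i] whose replacement [Ai] is in [F], contrary to
   [moved]. *)
have Ai' : j |: (Ai :\ i) \notin F.
  apply/negP => AF; have [] := moved _ AF; first by rewrite !inE eqxx (negPf neq_ij).
  by move=> _; rewrite setU1K ?setD1K ?AiF // !inE (negPf jAi) andbF.
have [Bj BjG hBj] := swap _ _ _ AjF jAj iAj Aj'.
have [Bi BiG hBi] := swap _ _ _ AiF iAi jAi Ai'.
apply: (product_of_cover (F' := shift i j F) (G' := shift i j G)); rewrite ?card_shift //;
    try exact: shift_uniform; try exact: shift_cross.
- by move=> A AF; have [//|iA] := boolP (i \in A); have [->] := moved _ AF iA.
- by move=> _ /imsetP[A AF ->]; exact: star.
- move=> B BG iB jB; have := mem_shift i j BG.
  by case: shift_setP => //; rewrite (negPf jB).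
- by split; [exists Ai; rewrite ?iAi ?jAi|exists Aj; rewrite ?jAj ?iAj].
- by split; [exists Bi|exists Bj].
Qed.

End Pair.

Lemma shifted_onS (E E' : {set 'I_n}) F : E' \subset E ->
  shifted_on val_n E F -> shifted_on val_n E' F.
Proof.
move=> /subsetP sE sF A x y AF /sE xE /sE yE; exact: sF.
Qed.

(** * Fully shifted families *)

Section FullyShifted.
Variables (i j : 'I_n).
Hypotheses (i0 : val i = 0) (j1 : val j = 1).
Let E := [set: 'I_n] :\ i :\ j.

Let ij : i < j. Proof. by rewrite [nat_of_ord i]i0 [nat_of_ord j]j1. Qed.

Lemma lt_outside x : x \in E -> 1 < x.
Proof.
rewrite mem_outside => /andP[xj xi].
have : val x != val j by rewrite (inj_eq val_inj).
have : val x != val i by rewrite (inj_eq val_inj).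
by rewrite i0 j1 /=; case: (nat_of_ord x) => [|[]].
Qed.

(** [B] misses the two leading points, so on a prefix with p points of [E] it has at most (p+1)/2
    elements. As [A] and [B] exceed p+2 together, [A] climbs above height 2. *)
Lemma hits_fully_shifted F G A B : shifted_on val_n [set: 'I_n] F -> cross F G ->
  A \in F -> B \in G -> i \notin B -> j \notin B ->
  (forall m, (#|B :&: prefix_set val_n E m|).*2 <= #|prefix_set val_n E m| + 1) ->
  hits val_n [set: 'I_n] 2 A.
Proof.
move=> sF FG AF BG iB jB bad.
have [m] := cross_prefix val_inj sF FG AF BG (subsetT _).
rewrite -/val_n; set X := prefix_set val_n _ m => hAB; exists m; rewrite -/X.
have := bad m; set Y := prefix_set val_n E m => hB.
have BX : B :&: X = B :&: Y.
  apply/setP => x; rewrite !inE; have [xB|//] := boolP (x \in B).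
  have xj : x != j by apply: contraNneq jB => <-.
  have xi : x != i by apply: contraNneq iB => <-.
  by rewrite xj xi.
have AX : #|A :&: X| <= #|X| by rewrite subset_leq_card // subsetIr.
case: (ltnP 1 m) => m1; last first.
  have Y0 : Y = set0.
    apply/setP => x; rewrite inE in_set0; apply/negP => /andP[/lt_outside x1 xm].
    by have := leq_trans xm m1; rewrite ltnNge (ltnW (x1 : 1 < val_n x)).
  by move: hAB; rewrite BX Y0 setI0 cards0 addn0 ltnNge AX.
have XE : X = i |: (j |: Y).
  apply/setP => x; rewrite !inE andbT.
  case: (x =P i) => [->|_] /=; first by rewrite [val_n i]i0 ltnW.
  by case: (x =P j) => [->|_] //=; rewrite [val_n j]j1.
have cX : #|X| = #|Y|.+2.
  have jY : j \notin Y by rewrite !inE eqxx.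
  have iY : i \notin j |: Y by rewrite !inE eqxx (negPf (neq_ij ij)) !andbF.
  by rewrite XE !cardsU1 jY iY.
have arith a b p : b.*2 <= p + 1 -> p.+2 < a + b -> p.+2 + 2 <= a.*2 by clear; lia.
by rewrite cX; apply: arith hB _; rewrite -cX -BX.
Qed.

(** Non-triviality gives a member without the first point; shifting one of its points to [j] if
    needed, and then [j] to [i], gives both members. *)
Lemma meets_differently_shifted F : uniform F -> shifted_on val_n [set: 'I_n] F ->
  nontriv F -> meets_differently i j F.
Proof.
move=> uF sF /nontrivP/(_ i)[A AF iA].
have jout x : x \in A -> x != j -> j < x.
  move=> xA xj; rewrite [nat_of_ord j]j1 lt_outside // mem_outside xj /=.
  by apply: contraNneq iA => <-.
have [B BF /andP[jB iB]] : exists2 B, B \in F & (j \in B) && (i \notin B).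
  have [jA|jA] := boolP (j \in A); first by exists A; rewrite ?jA.
  have /subsetsP[_ Ak] := subsetP uF _ AF.
  have /card_gt0P[x xA] : 0 < #|A| by rewrite Ak; apply: leq_trans k8.
  have xj : x != j by apply: contraNneq jA => <-.
  exists (j |: (A :\ x)); first by apply: sF => //; exact: jout.
  by rewrite !inE eqxx (negPf (neq_ij ij)) (negPf iA) andbF.
split; last by exists B; rewrite ?jB.
exists (i |: (B :\ j)); first exact: sF.
by rewrite !inE !eqxx (eq_sym j i) (negPf (neq_ij ij)).
Qed.

Lemma product_of_fully_shifted F G : uniform F -> uniform G -> cross F G ->
  shifted_on val_n [set: 'I_n] F -> shifted_on val_n [set: 'I_n] G ->
  nontriv F -> nontriv G -> #|F| * #|G| <= HM_bound n k ^ 2.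
Proof.
move=> uF uG FG sF sG ntF ntG.
have [badG|[Y]] := hits_or_bad E (colink j (colink i G)); last first.
  case/colinkP=> /colinkP[YG iY] jY bad.
  apply: (product_of_hits_ord (r := val_n)) => // A AF.
  exact: hits_fully_shifted sF FG AF YG iY jY bad.
have [badF|[Y]] := hits_or_bad E (colink j (colink i F)); last first.
  case/colinkP=> /colinkP[YF iY] jY bad; rewrite mulnC.
  apply: (product_of_hits_ord (r := val_n)) => //; first exact: crossC.
  move=> A AG; exact: hits_fully_shifted sG (crossC FG) AG YF iY jY bad.
have [f1 f2] := meets_differently_shifted uF sF ntF.
have [g1 g2] := meets_differently_shifted uG sG ntG.
have [F1 F2] := links_nonempty (neq_ij ij) f1 f2.
have [G1 G2] := links_nonempty (neq_ij ij) g1 g2.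
rewrite -[X in HM_bound X](card_ord n).
by apply: (product_of_shifted val_inj (neq_ij ij)) => //; rewrite ?card_ord //;
  apply: shifted_onS (subsetT _) _.
Qed.

End FullyShifted.

(** * The main induction *)

Lemma nontrivS F G : F \subset G -> nontriv F -> nontriv G.
Proof.
move=> sFG /nontrivP ntF; apply/nontrivP => c; have [A AF cA] := ntF c.
by exists A => //; exact: (subsetP sFG).
Qed.

(** Induction on the missing weight: saturate first, then shift while both families stay
    non-trivial. Neither step lowers the product. *)
Lemma product_of_nontrivial F G : uniform F -> uniform G -> cross F G ->
  nontriv F -> nontriv G -> #|F| * #|G| <= HM_bound n k ^ 2.
Proof.
have [w] := ubnP (Weight [set: {set 'I_n}] - Weight F + (Weight [set: {set 'I_n}] - Weight G)).
elim: w F G => // w IH F G hw uF uG FG ntF ntG.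
have arith W a b a' b' : W - a + (W - b) < w.+1 -> a <= a' <= W -> b <= b' <= W ->
    (a < a') || (b < b') -> W - a' + (W - b') < w by clear; lia.
(* Either a set can be added to [F1], and induction applies, or [F1] is saturated. The claim is
   general so that it serves both orders of [F] and [G]. *)
have sat F1 G1 (P := fun A => (A \in subsets [set: 'I_n] k) && (A \notin F1)) :
    Weight [set: {set 'I_n}] - Weight F1 + (Weight [set: {set 'I_n}] - Weight G1) < w.+1 ->
    uniform F1 -> uniform G1 -> cross F1 G1 -> nontriv F1 -> nontriv G1 ->
    #|F1| * #|G1| <= HM_bound n k ^ 2 \/
    (forall A, A \in subsets [set: 'I_n] k -> (forall B, B \in G1 -> A :&: B != set0) -> A \in F1).
  move=> hw1 uF1 uG1 FG1 ntF1 ntG1.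
  case: (boolP [exists A in subsets [set: 'I_n] k, (A \notin F1) && [forall B in G1, A :&: B != set0]]).
    case/exists_inP=> A Ak /andP[AF1 /forall_inP AG1]; left.
    apply: (@leq_trans (#|A |: F1| * #|G1|)).
      by rewrite leq_mul2r cardsU1 leq_addl orbT.
    apply: IH => //.
    - apply: arith hw1 _ _ _; rewrite ?Weight_max ?leqnn ?andbT //; last by rewrite Weight_setU1.
      by rewrite ltnW // Weight_setU1.
    - by rewrite subUset sub1set Ak.
    - by move=> A1 B /setU1P[->|AF] BG; [exact: AG1|exact: FG1].
    - exact: nontrivS (subsetUr _ _) ntF1.
  move=> nex; right=> A Ak AG1; apply: contraR nex => AF1.
  by apply/exists_inP; exists A => //; rewrite AF1; apply/forall_inP.
have [//|satF] := sat _ _ hw uF uG FG ntF ntG.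
have hw' := hw; rewrite addnC in hw'.
have [|satG] := sat _ _ hw' uG uF (crossC FG) ntG ntF; first by rewrite mulnC.
case: (boolP [exists i : 'I_n, exists j : 'I_n, (i < j) && ((shift i j F != F) || (shift i j G != G))]).
  case/existsP=> i /existsP[j /andP[ij mv]].
  have [ntF'|tF] := boolP (nontriv (shift i j F)); last first.
    exact: (product_of_trivial_shift ij uF uG FG ntF satF tF).
  have [ntG'|tG] := boolP (nontriv (shift i j G)); last first.
    rewrite mulnC; exact: (product_of_trivial_shift ij uG uF (crossC FG) ntG satG tG).
  rewrite -(card_shift i j F) -(card_shift i j G); apply: IH => //;
    try exact: shift_uniform; try exact: shift_cross.
  have le H : Weight H <= Weight (shift i j H) by case: (Weight_shift H ij).
  apply: arith hw _ _ _; rewrite ?le ?Weight_max //.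
  by rewrite !(ltn_leqif (Weight_shift _ ij)).
move=> stable.
have fixed H : (H == F) || (H == G) -> shifted_on val_n [set: 'I_n] H.
  move=> HH; apply: shifted_on_stable => i j _ _ ij; apply/eqP/negPn/negP => mv.
  case/negP: stable; apply/existsP; exists i; apply/existsP; exists j; rewrite [i < j]ij /=.
  by case/orP: HH mv => /eqP -> ->; rewrite ?orbT.
have n0 : 0 < n by lia.
have n1 : 1 < n by lia.
by apply: (@product_of_fully_shifted (Ordinal n0) (Ordinal n1)) => //; apply: fixed; rewrite eqxx ?orbT.
Qed.

End Main.

Lemma non_trivial_nontriv n (F : {set {set 'I_n}}) : non_trivial F -> nontriv F.
Proof.
move=> ntF; apply/nontrivP => c; apply/exists_inP; apply: contraT.
rewrite negb_exists_in => /forall_inP h.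
have : c \in \bigcap_(A in F) A by apply/bigcapP => A /h; rewrite negbK.
by rewrite ntF inE.
Qed.

Theorem theorem1p6 (n k : nat) (F G : {set {set 'I_n}}) :
  8 <= k -> 2 * k + 1 <= n -> n <= 4 * k ->
  k_uniform k F -> k_uniform k G ->
  cross_intersecting F G ->
  non_trivial F -> non_trivial G ->
  #|F| * #|G| <= ('C(n - 1, k - 1) - 'C(n - k - 1, k - 1) + 1) ^ 2.
Proof.
move=> k8 nk n4k uF uG FG ntF ntG.
have uniform (H : {set {set 'I_n}}) : k_uniform k H -> H \subset subsets [set: 'I_n] k.
  by move=> uH; apply/subsetP => A /uH Ak; apply/subsetsP; rewrite subsetT.
by apply: product_of_nontrivial => //; [exact: uniform|exact: uniform| |];
  exact: non_trivial_nontriv.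
Qed.
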